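(* Let $k\ge 3$, $\Psi\subseteq\mathbb{R}^{k-2}$, and for each $\bm{\psi}\in\Psi$ let $f_0(\cdot|\bm{\psi})$ be a continuous circular probability density, symmetric about $0$, with $p$th cosine moments $\alpha_{0,p}(\bm{\psi})$. Assume that (i) for any $\bm{\psi}\in\Psi$, $\alpha_{0,1}(\bm{\psi})\neq 0$; (ii) for any $\bm{\psi}\in\Psi$, there exists a constant $M=M(\bm{\psi})>0$ such that $$\inf_{p\in\mathbb{N}}\left|\frac{\alpha_{0,p-1}(\bm{\psi})-\alpha_{0,p+1}(\bm{\psi})}{\alpha_{0,p}(\bm{\psi})}\right|>\frac1M;$$ (iii) there exists a constant $c\ge 0$ such that for any $\bm{\psi}\in\Psi$, $$\frac{\alpha_{0,p-1}(\bm{\psi})-\alpha_{0,p+1}(\bm{\psi})}{\alpha_{0,p}(\bm{\psi})}=O(p^c)\qquad (p\to\infty),$$ and for any $\bm{\psi}_1\neq\bm{\psi}_2$ ($\bm{\psi}_1,\bm{\psi}_2\in\Psi$), either $$\frac{\alpha_{0,p}(\bm{\psi}_1)}{\alpha_{0,p}(\bm{\psi}_2)}p^{c}\to 0\quad(p\to\infty)\qquad\text{or}\qquad \frac{\alpha_{0,p}(\bm{\psi}_1)}{\alpha_{0,p}(\bm{\psi}_2)}p^{-c}\to\infty\quad(p\to\infty).$$ Then the family $\{f(\theta|\bm{\gamma})\mid\bm{\gamma}\in\Gamma\}$ of sine-skewed densities $$f(\theta|\bm{\gamma})=f_0(\theta-\mu|\bm{\psi})\{1+\lambda\sin(\theta-\mu)\},\qquad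 \bm{\gamma}=(\mu,\bm{\psi}^T,\lambda)^T,$$ with $\Gamma=\{\bm{\gamma}\mid\mu\in[0,2\pi),\ \bm{\psi}\in\Psi,\ \lambda\in[-1,1]\}$, is identifiable.
   Context: A circular density is a $2\pi$-periodic non-negative function on $\mathbb{R}$ that integrates to $1$ over an interval of length $2\pi$. Symmetry about $0$ means $f_0(2\pi-\theta|\bm{\psi})=f_0(\theta|\bm{\psi})$ for all $\theta\in(0,2\pi)$. The $p$th cosine moment is $\alpha_{0,p}(\bm{\psi})=\int_0^{2\pi}\cos(p\theta)f_0(\theta|\bm{\psi})\,d\theta$. In (ii) and (iii), $p$ ranges over positive integers, and limits are taken along integers $p\to\infty$; the ratios are presupposed to be well defined (nonzero denominators). Identifiability: a family $\{f(\cdot|\bm{\gamma})\mid\bm{\gamma}\in\Gamma\}$ of densities is identifiable if $\bm{\gamma}_1\neq\bm{\gamma}_2$ in $\Gamma$ implies that $f(\cdot|\bm{\gamma}_1)$ and $f(\cdot|\bm{\gamma}_2)$ define different distributions (different cumulative distribution functions; equivalently, the densities are not equal almost everywhere). *)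

(* Defs.v *)
From HB Require Import structures.
From mathcomp Require Import all_boot all_order all_algebra.
From mathcomp Require Import all_classical all_reals all_analysis.
Set Implicit Arguments.
Unset Strict Implicit.
Unset Printing Implicit Defensive.
Import Order.TTheory GRing.Theory Num.Theory.
Import numFieldNormedType.Exports.
Local Open Scope classical_set_scope.
Local Open Scope ring_scope.

(* Periodicity makes the choice of the interval of length 2 pi immaterial. *)
Definition circular_density (R : realType) (f : R -> R) : Prop :=
  [/\ measurable_fun setT f,
      forall x, 0 <= f x,
      forall x, f (x + 2 * pi) = f x
    & (\int[lebesgue_measure]_(x in `[0%R, (2 * pi)%R]) (f x)%:E = 1)%E].

Definition symmetric_about0 (R : realType) (f : R -> R) : Prop :=
  forall x, 0 < x < 2 * pi -> f (2 * pi - x) = f x.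

Definition cosine_moment (R : realType) (f : R -> R) (p : nat) : R :=
  \int[lebesgue_measure]_(x in `[0, 2 * pi]) (cos (p%:R * x) * f x).

(* Only meaningful for [0 < p] and a nonzero [p]th moment. *)
Definition moment_ratio (R : realType) (f : R -> R) (p : nat) : R :=
  (cosine_moment f p.-1 - cosine_moment f p.+1) / cosine_moment f p.

Definition circular_cdf (R : realType) (f : R -> R) (x : R) : R :=
  \int[lebesgue_measure]_(t in `[0, x]) f t.

Definition same_distribution (R : realType) (f g : R -> R) : Prop :=
  forall x, 0 <= x <= 2 * pi -> circular_cdf f x = circular_cdf g x.

Definition identifiable (R : realType) (G : Type) (Gam : set G)
    (f : G -> R -> R) : Prop :=
  forall g1 g2, Gam g1 -> Gam g2 -> g1 <> g2 ->
    ~ same_distribution (f g1) (f g2).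

(* A parameter gamma = (mu, psi, lambda) is the triple [(mu, psi, lambda)]. *)
Definition sine_skewed (R : realType) (d : nat) (f0 : 'cV[R]_d -> R -> R)
    (g : R * 'cV[R]_d * R) (x : R) : R :=
  let: (mu, psi, lambda) := g in
  f0 psi (x - mu) * (1 + lambda * sin (x - mu)).

Definition sine_skewed_params (R : realType) (d : nat) (Psi : set 'cV[R]_d) :
    set (R * 'cV[R]_d * R) :=
  [set g | let: (mu, psi, lambda) := g in
     [/\ 0 <= mu < 2 * pi, Psi psi & -1 <= lambda <= 1]].

(* Main.v *)
Require Import Defs.
From HB Require Import structures.
From mathcomp Require Import all_boot all_order all_algebra.
From mathcomp Require Import ring lra.
From mathcomp Require Import all_classical all_reals all_analysis.
Set Implicit Arguments.
Unset Strict Implicit.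
Unset Printing Implicit Defensive.
Import Order.TTheory GRing.Theory Num.Theory.
Import numFieldNormedType.Exports.
Local Open Scope classical_set_scope.
Local Open Scope ring_scope.

(** Let a_p(psi) be the cosine moments of [f0 psi], and let r_p(psi) be
    [moment_ratio (f0 psi) p].  Two sine-skewed densities with the same
    distribution function agree on the open interval from 0 to 2 pi, hence they
    have the same trigonometric moments.  By symmetry of [f0 psi] and the
    product formula for sin (p x) sin x, the p-th Fourier coefficient of the
    density with parameters (mu, psi, lambda) is

      exp (i p mu) a_p(psi) (1 + i lambda r_p(psi) / 2)

    ([rotated_skew_moments]; real and imaginary parts are kept separately).
    So everything is read off the equality of these numbers for all p > 0.

    If psi1 and psi2 differ, moduli give the value of (a_p(psi1) / a_p(psi2))^2
    as a quotient of two factors 1 + (lambda r_p / 2)^2, each between 1 and a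
    constant times p^(2c) for large p.  Thus the quotient of the moments lies in
    absolute value, up to constants, between p^(-c) and p^c, which excludes both alternatives of the
    separation hypothesis ([modulus_ratio_not_separated]).

    If psi1 = psi2, the factor a_p cancels.  Moduli at p = 1 give
    lambda1 = lambda2 or lambda1 = - lambda2.  In the first case
    exp (i mu1) = exp (i mu2), so mu1 = mu2.  In the second case, with
    lambda <> 0,

      exp (i p (mu1 - mu2)) = (1 - i b) / (1 + i b),   |b| = |lambda r_p| / 2,

    and the real part (1 - b^2) / (1 + b^2) stays away from 1 uniformly in p,
    as |r_p| is bounded below.  But the powers of a point of the unit circle
    return arbitrarily close to 1 ([cos_recurrence], Dirichlet's pigeonhole
    argument): a contradiction ([opposite_skew_impossible]). *)

(** * Integrals of continuous functions *)

Section Calculus.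
Variable R : realType.
Implicit Types (f g F : R -> R) (a b t A T : R).
Local Notation mu := (@lebesgue_measure R).

Lemma continuous_integrable_segment f a b :
  continuous f -> mu.-integrable `[a, b] (EFin \o f).
Proof.
move=> cf; apply: continuous_compact_integrable; first exact: segment_compact.
exact: continuous_subspaceT.
Qed.

(** A half-line is enough: [A] can be taken to the left of every argument in
    play. *)
Lemma exists_primitive_right f A : continuous f ->
  exists F, forall x, A < x -> is_derive x 1 F (f x).
Proof.
move=> cf; exists (fun x => \int[mu]_(t in `[A, x]) f t) => x Ax.
have [] := @continuous_FTC1_closed R f A x (x + 1) _ _ Ax (cf x).
- by rewrite ltrDl.
- exact: continuous_integrable_segment.
by rewrite derive1E => dF eF; apply: DeriveDef.
Qed.

Lemma Rintegral_primitive f F a b : a < b -> continuous f ->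
  (forall x, a <= x <= b -> is_derive x 1 F (f x)) ->
  \int[mu]_(x in `[a, b]) f x = F b - F a.
Proof.
move=> ab cf dF.
have cF x : a <= x <= b -> {for x, continuous F}.
  move=> /dF dFx; apply: differentiable_continuous; apply/derivable1_diffP.
  exact: ex_derive.
rewrite /Rintegral (@continuous_FTC2 R f F a b ab) //.
- exact: continuous_subspaceT.
- split.
  + move=> x; rewrite in_itv/= => /andP[ax xb].
    by have := dF x; rewrite !ltW // => /(_ isT) ?; exact: ex_derive.
  + by apply: cvg_at_right_filter; apply: cF; rewrite lexx ltW.
  + by apply: cvg_at_left_filter; apply: cF; rewrite lexx ltW.
- move=> x; rewrite in_itv/= => /andP[ax xb].
  by have := dF x; rewrite !ltW // => /(_ isT) ?; rewrite derive1E derive_val.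
Qed.

Lemma is_derive_shift F t x df :
  is_derive (x + t) 1 F df -> is_derive x 1 (fun y => F (y + t)) df.
Proof.
move=> dF.
have dt : is_derive x 1 (fun y : R => y + t) 1.
  by apply: is_derive_eq; rewrite addr0.
by have := @is_derive1_comp R F (fun y => y + t) x _ _ dF dt; rewrite mulr1.
Qed.

(** With F a primitive of f, both sides are values of F (t + T) - F t, whose
    derivative f (t + T) - f t vanishes. *)
Lemma Rintegral_shift_period f T t : 0 < T -> continuous f ->
  (forall x, f (x + T) = f x) ->
  \int[mu]_(x in `[0, T]) f (x + t) = \int[mu]_(x in `[0, T]) f x.
Proof.
move=> T0 cf pf.
(* [A] lies to the left of both 0 and [t]. *)
pose A := - (1 + `|t|).
have At : A < t.
  by have := lerNnormlW (lexx `|t|); rewrite /A; lra.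
have A0 : A < 0 by rewrite /A; have := normr_ge0 t; lra.
have [F dF] := exists_primitive_right A cf.
have cft : continuous (fun x => f (x + t)).
  move=> x; apply: continuous_comp; last exact: cf.
  by apply: cvgD; [exact: cvg_id | exact: cvg_cst].
have -> : \int[mu]_(x in `[0, T]) f x = F T - F 0.
  by apply: Rintegral_primitive => // x /andP[x0 _]; apply: dF; lra.
have -> : \int[mu]_(x in `[0, T]) f (x + t) = F (T + t) - F (0 + t).
  apply: (@Rintegral_primitive _ (fun x => F (x + t)) 0 T) => // x /andP[x0 _].
  by apply: is_derive_shift; apply: dF; lra.
pose H x := F (x + T) - F x.
have dH x : A < x -> is_derive x 1 H 0.
  move=> Ax.
  have d1 : is_derive x 1 (fun y => F (y + T)) (f x).
    by apply: is_derive_shift; rewrite -(pf x); apply: dF; lra.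
  have d2 := dF x Ax.
  by rewrite -(subrr (f x)); exact: is_deriveB.
have HE u v : A < u -> u <= v -> H v = H u.
  move=> Au uv; apply/eqP; rewrite -subr_eq0; apply/eqP.
  have [| |c _ ->] := @MVT_segment R H (cst 0) u v uv; last by rewrite mul0r.
    by move=> x; rewrite in_itv/= => /andP[ux _]; apply: dH; lra.
  apply: derivable_within_continuous => x; rewrite in_itv/= => /andP[ux _].
  by have := dH x; rewrite (lt_le_trans Au ux) => /(_ isT) ?; exact: ex_derive.
have : H t = H 0.
  by have [t0|t0] := leP 0 t; [exact: HE|apply/esym/HE => //; exact: ltW].
by rewrite /H !add0r (addrC t).
Qed.

Lemma Rintegral_reflect f T : 0 < T -> continuous f ->
  \int[mu]_(x in `[0, T]) f (T - x) = \int[mu]_(x in `[0, T]) f x.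
Proof.
move=> T0 cf.
have [F dF] := exists_primitive_right (-1) cf.
have -> : \int[mu]_(x in `[0, T]) f x = F T - F 0.
  by apply: Rintegral_primitive => // x /andP[x0 _]; apply: dF; lra.
have cr : continuous (fun x : R => T - x).
  by move=> x; apply: cvgB; [exact: cvg_cst | exact: cvg_id].
have -> : F T - F 0 = - F (T - T) - - F (T - 0).
  by rewrite subrr subr0 opprK addrC.
apply: (@Rintegral_primitive _ (fun x => - F (T - x)) 0 T) => //.
  by move=> x; apply: continuous_comp; [exact: cr | exact: cf].
move=> x /andP[x0 xT].
have dx : is_derive x 1 (fun y : R => T - y) (-1).
  by apply: is_derive_eq; rewrite add0r mul1r.
have dFx : is_derive (T - x) 1 F (f (T - x)) by apply: dF; lra.
have := @is_derive1_comp R F (fun y => T - y) x _ _ dFx dx.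
by rewrite mulrN1 => h; have := is_deriveN h; rewrite opprK.
Qed.

(** Differentiating the hypothesis at [x] requires it on both sides of [x], which
    is why the conclusion leaves out the endpoints. *)
Lemma eq_of_eq_primitive f g b : continuous f -> continuous g ->
  (forall x, 0 <= x <= b ->
     \int[mu]_(t in `[0, x]) f t = \int[mu]_(t in `[0, x]) g t) ->
  forall x, 0 < x < b -> f x = g x.
Proof.
move=> cf cg fg x /andP[x0 xb].
have Hd h : continuous h ->
    derive1 (fun y => \int[mu]_(t in `[0, y]) h t) x = h x.
  move=> ch; have [] // := @continuous_FTC1_closed R h 0 x (x + 1) _ _ x0 (ch x).
  - by rewrite ltrDl.
  - exact: continuous_integrable_segment.
rewrite -(Hd f) // -(Hd g) //; rewrite !derive1E; apply: near_eq_derive.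
near=> y; apply: fg; apply/andP; split; apply: ltW; near: y.
- exact: lt_nbhsr.
- exact: lt_nbhsl.
Unshelve. all: by end_near. Qed.

End Calculus.

(** * Trigonometric moments of sine-skewed densities *)

Section TrigonometricMoments.
Variable R : realType.
Implicit Types (f g : R -> R) (p : nat) (m l x : R).
Local Notation mu := (@lebesgue_measure R).
Local Notation period := (2 * (@pi R)).

Lemma period_gt0 : 0 < period.
Proof. by rewrite mulr_gt0 // pi_gt0. Qed.

Lemma eq_Rintegral_oo f g (T : R) : continuous f -> continuous g ->
  (forall x, 0 < x < T -> f x = g x) ->
  \int[mu]_(x in `[0, T]) f x = \int[mu]_(x in `[0, T]) g x.
Proof.
move=> cf cg fg.
have oo h : continuous h ->
    \int[mu]_(x in `[0, T]) h x = \int[mu]_(x in `]0, T[) h x.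
  move=> ch; have ih := @continuous_integrable_segment R h 0 T ch.
  rewrite -Rintegral_itv_bndo_bndc; last first.
    apply: integrableS ih => //.
    by apply: subset_itvl; rewrite bnd_simp.
  rewrite -Rintegral_itv_obnd_cbnd //.
  apply: integrableS ih => //.
  by apply: subset_itv; rewrite bnd_simp.
rewrite oo // oo //; apply: eq_Rintegral => x.
by rewrite inE/= in_itv/= => /fg.
Qed.

Lemma Rintegral_lin f g a b (T : R) : continuous f -> continuous g ->
  \int[mu]_(x in `[0, T]) (a * f x + b * g x) =
  a * \int[mu]_(x in `[0, T]) f x + b * \int[mu]_(x in `[0, T]) g x.
Proof.
move=> cf cg.
have cZ (h : R -> R) e : continuous h -> continuous (fun x => e * h x).
  by move=> ch x; apply: cvgM; [exact: cvg_cst | exact: ch].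
rewrite RintegralD //; try by apply: continuous_integrable_segment; exact: cZ.
by rewrite !RintegralZl //; exact: continuous_integrable_segment.
Qed.

(** The hypothesis is limited to the open interval because [symmetric_about0]
    is. *)
Lemma Rintegral_antisymmetric f (T : R) : 0 < T -> continuous f ->
  (forall x, 0 < x < T -> f (T - x) = - f x) ->
  \int[mu]_(x in `[0, T]) f x = 0.
Proof.
move=> T0 cf odd.
have cr : continuous (fun x => f (T - x)).
  move=> x; apply: continuous_comp; last exact: cf.
  by apply: cvgB; [exact: cvg_cst | exact: cvg_id].
have : \int[mu]_(x in `[0, T]) f x = - \int[mu]_(x in `[0, T]) f x.
  rewrite -{1}Rintegral_reflect // -mulN1r -RintegralZl //; last first.
    exact: continuous_integrable_segment.
  apply: eq_Rintegral_oo => // x; first by apply: cvgM; [exact: cvg_cst|exact: cf].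
  by move=> /odd ->; rewrite mulN1r.
lra.
Qed.

Lemma cosM_period p x : cos (p%:R * (x + period)) = cos (p%:R * x).
Proof.
have -> : p%:R * (x + period) = p%:R * x + (pi *+ 2) *+ p.
  by rewrite mulrDr (mulr_natl pi) (mulr_natl (pi *+ 2)).
by rewrite periodicn //; exact: cosD2pi.
Qed.

Lemma sinM_period p x : sin (p%:R * (x + period)) = sin (p%:R * x).
Proof.
have -> : p%:R * (x + period) = p%:R * x + (pi *+ 2) *+ p.
  by rewrite mulrDr (mulr_natl pi) (mulr_natl (pi *+ 2)).
by rewrite periodicn //; exact: sinD2pi.
Qed.

Lemma cosM_reflect p x : cos (p%:R * (period - x)) = cos (p%:R * x).
Proof. by rewrite addrC cosM_period mulrN cosN. Qed.

Lemma sinM_reflect p x : sin (p%:R * (period - x)) = - sin (p%:R * x).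
Proof. by rewrite addrC sinM_period mulrN sinN. Qed.

Lemma continuous_cos_weight f p :
  continuous f -> continuous (fun x => cos (p%:R * x) * f x).
Proof.
move=> cf x; apply: cvgM; last exact: cf.
apply: continuous_comp; last exact: continuous_cos.
by apply: cvgM; [exact: cvg_cst | exact: cvg_id].
Qed.

Lemma continuous_sin_weight f p :
  continuous f -> continuous (fun x => sin (p%:R * x) * f x).
Proof.
move=> cf x; apply: cvgM; last exact: cf.
apply: continuous_comp; last exact: continuous_sin.
by apply: cvgM; [exact: cvg_cst | exact: cvg_id].
Qed.

Definition skew f l x := f x * (1 + l * sin x).

Lemma continuous_skew f l : continuous f -> continuous (skew f l).
Proof.
move=> cf x; apply: cvgM; first exact: cf.
apply: cvgD; first exact: cvg_cst.
by apply: cvgM; [exact: cvg_cst | exact: continuous_sin].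
Qed.

(** The skewing term contributes cos (p x) sin x f x, which is odd about pi. *)
Lemma cosine_moment_skew f l p : continuous f -> symmetric_about0 f ->
  cosine_moment (skew f l) p = cosine_moment f p.
Proof.
move=> cf sf; rewrite /cosine_moment.
have csf : continuous (fun x => sin x * f x).
  by move=> x; apply: cvgM; [exact: continuous_sin | exact: cf].
have c1 := @continuous_cos_weight _ p cf; have c2 := @continuous_cos_weight _ p csf.
transitivity (\int[mu]_(x in `[0, period])
    (1 * (cos (p%:R * x) * f x) + l * (cos (p%:R * x) * (sin x * f x)))).
  by apply: eq_Rintegral => x _; rewrite /skew; ring.
rewrite Rintegral_lin // mul1r.
rewrite [X in _ + _ * X]Rintegral_antisymmetric ?mulr0 ?addr0 //.
  exact: period_gt0.
move=> x /sf fx; rewrite fx cosM_reflect.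
have := sinM_reflect 1 x; rewrite !mul1r => ->; ring.
Qed.

Definition sine_moment f p := \int[mu]_(x in `[0, period]) (sin (p%:R * x) * f x).

(** The unskewed part sin (p x) f x is odd about pi; the rest is the product
    formula 2 sin (p x) sin x = cos ((p - 1) x) - cos ((p + 1) x). *)
Lemma sine_moment_skew f l p : (0 < p)%N -> continuous f -> symmetric_about0 f ->
  sine_moment (skew f l) p =
  l / 2 * (cosine_moment f p.-1 - cosine_moment f p.+1).
Proof.
case: p => // p _ cf sf; rewrite /sine_moment /cosine_moment /=.
have cs := @continuous_sin_weight _ p.+1 cf.
have cc q := @continuous_cos_weight _ q cf.
have cd : continuous (fun x =>
    l / 2 * (cos (p%:R * x) * f x) + - (l / 2) * (cos (p.+2%:R * x) * f x)).
  move=> x; apply: cvgD; apply: cvgM; by [exact: cvg_cst | exact: cc].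
transitivity (\int[mu]_(x in `[0, period]) (1 * (sin (p.+1%:R * x) * f x) +
    1 * (l / 2 * (cos (p%:R * x) * f x) +
         - (l / 2) * (cos (p.+2%:R * x) * f x)))).
  apply: eq_Rintegral => x _; rewrite /skew.
  have -> : p%:R * x = p.+1%:R * x - x by rewrite -natr1; ring.
  have -> : p.+2%:R * x = p.+1%:R * x + x by rewrite -natr1; ring.
  by rewrite cosB cosD; field.
rewrite Rintegral_lin // Rintegral_lin //.
rewrite [X in 1 * X + _]Rintegral_antisymmetric //; first by ring.
  exact: period_gt0.
by move=> x /sf fx; rewrite fx sinM_reflect mulNr.
Qed.

(** Rotating by [m] multiplies the p-th Fourier coefficient by exp (i p m); this
    lemma and the next are its real and imaginary parts. *)
Lemma cosine_moment_rotate f m p :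
  continuous f -> (forall x, f (x + period) = f x) ->
  cosine_moment (fun x => f (x - m)) p =
  cos (p%:R * m) * cosine_moment f p - sin (p%:R * m) * sine_moment f p.
Proof.
move=> cf pf; rewrite /cosine_moment /sine_moment.
have cc := @continuous_cos_weight _ p cf; have cs := @continuous_sin_weight _ p cf.
pose h x := cos (p%:R * m) * (cos (p%:R * x) * f x) +
            - sin (p%:R * m) * (sin (p%:R * x) * f x).
transitivity (\int[mu]_(x in `[0, period]) h (x - m)).
  apply: eq_Rintegral => x _; rewrite /h.
  have -> : p%:R * x = p%:R * (x - m) + p%:R * m by ring.
  by rewrite cosD; ring.
rewrite (Rintegral_shift_period (f := h)); first by rewrite Rintegral_lin // mulNr.
- exact: period_gt0.
- by move=> x; apply: cvgD; apply: cvgM; by [exact: cvg_cst|exact: cc|exact: cs].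
- by move=> x; rewrite /h cosM_period sinM_period pf.
Qed.

Lemma sine_moment_rotate f m p :
  continuous f -> (forall x, f (x + period) = f x) ->
  sine_moment (fun x => f (x - m)) p =
  sin (p%:R * m) * cosine_moment f p + cos (p%:R * m) * sine_moment f p.
Proof.
move=> cf pf; rewrite /cosine_moment /sine_moment.
have cc := @continuous_cos_weight _ p cf; have cs := @continuous_sin_weight _ p cf.
pose h x := sin (p%:R * m) * (cos (p%:R * x) * f x) +
            cos (p%:R * m) * (sin (p%:R * x) * f x).
transitivity (\int[mu]_(x in `[0, period]) h (x - m)).
  apply: eq_Rintegral => x _; rewrite /h.
  have -> : p%:R * x = p%:R * (x - m) + p%:R * m by ring.
  by rewrite sinD; ring.
rewrite (Rintegral_shift_period (f := h)); first by rewrite Rintegral_lin.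
- exact: period_gt0.
- by move=> x; apply: cvgD; apply: cvgM; by [exact: cvg_cst|exact: cc|exact: cs].
- by move=> x; rewrite /h cosM_period sinM_period pf.
Qed.

Lemma same_distribution_moments f g p : continuous f -> continuous g ->
  same_distribution f g ->
  cosine_moment f p = cosine_moment g p /\ sine_moment f p = sine_moment g p.
Proof.
move=> cf cg fg; have eq_fg := eq_of_eq_primitive cf cg fg.
split; apply: eq_Rintegral_oo => [||x /eq_fg -> //];
  by [exact: continuous_cos_weight | exact: continuous_sin_weight].
Qed.

(** Real and imaginary parts of exp (i p m) a (1 + i b). *)
Lemma rotated_skew_moments f m l p : (0 < p)%N -> continuous f ->
  (forall x, f (x + 2 * pi) = f x) -> symmetric_about0 f ->
  cosine_moment f p != 0 ->
  let g x := skew f l (x - m) in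
  let a := cosine_moment f p in
  let b := l / 2 * moment_ratio f p in
  cosine_moment g p = a * (cos (p%:R * m) - sin (p%:R * m) * b) /\
  sine_moment g p = a * (sin (p%:R * m) + cos (p%:R * m) * b).
Proof.
move=> p0 cf pf sf an0 g a b.
have ck := @continuous_skew f l cf.
have pk x : skew f l (x + 2 * pi) = skew f l x.
  rewrite /skew pf; have := sinM_period 1 x; rewrite !mul1r => -> //.
have sE : sine_moment (skew f l) p = a * b.
  by rewrite sine_moment_skew // /b /moment_ratio -/a; field.
rewrite cosine_moment_rotate // sine_moment_rotate // cosine_moment_skew // sE.
by rewrite -/a; split; ring.
Qed.

End TrigonometricMoments.

(** * Recurrence of rotations *)

Section Recurrence.
Variable R : realType.
Implicit Types d e : R.

Lemma angle_mod_2pi (p : nat) d : 0 <= d -> exists t : R,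
  [/\ 0 <= t < 1, cos (p%:R * d) = cos (t * (pi *+ 2)) &
      sin (p%:R * d) = sin (t * (pi *+ 2))].
Proof.
move=> d0; have P0 : 0 < (pi *+ 2 : R) by rewrite pmulrn_lgt0 // pi_gt0.
set y := p%:R * d / (pi *+ 2).
have y0 : 0 <= y by rewrite /y divr_ge0 ?mulr_ge0 // ltW.
have /andP[ky yk] := truncn_itv y0.
have -> : p%:R * d =
    (y - (Num.truncn y)%:R) * (pi *+ 2) + (pi *+ 2) *+ Num.truncn y.
  by rewrite mulrBl (mulr_natl (pi *+ 2)) subrK /y mulfVK // gt_eqF.
exists (y - (Num.truncn y)%:R); split.
- by rewrite subr_ge0 ky /= ltrBlDr addrC natr1.
- by rewrite periodicn //; exact: cosD2pi.
- by rewrite periodicn //; exact: sinD2pi.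
Qed.

(** Among [N.+2] points, two have the same integer part after scaling by
    [N.+1]. *)
Lemma pigeonhole_unit_interval (t : nat -> R) (N : nat) :
  (forall i, 0 <= t i < 1) ->
  exists i j, [/\ (i < j)%N & `|t i - t j| < N.+1%:R^-1].
Proof.
move=> t01.
pose f (i : 'I_N.+2) : 'I_N.+1 := inord (Num.truncn (N.+1%:R * t i)).
have fE i : f i = Num.truncn (N.+1%:R * t i) :> nat.
  rewrite inordK //; have /andP[t0 t1] := t01 i.
  have N0 : (0 : R) <= N.+1%:R * t i by rewrite mulr_ge0.
  have /andP[le_tr _] := truncn_itv N0.
  rewrite -(ltr_nat R); apply: le_lt_trans le_tr _.
  by rewrite -[ltRHS]mulr1 ltr_pM2l.
have /injectivePn [i [j ij fij]] : ~~ injectiveb f.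
  apply/negP => /injectiveP /leq_card; by rewrite !card_ord ltnn.
have close : `|t i - t j| < N.+1%:R^-1.
  have /andP[i0 i1] := t01 i; have /andP[j0 j1] := t01 j.
  have /andP[a1 a2] := truncn_itv (mulr_ge0 (ler0n R N.+1) i0).
  have /andP[c1 c2] := truncn_itv (mulr_ge0 (ler0n R N.+1) j0).
  move: a1 a2; rewrite -fE fij fE => a1 a2.
  rewrite -(ltr_pM2l (ltr0Sn R N)) divff ?pnatr_eq0 //.
  rewrite -[X in X * _](ger0_norm (ler0n R N.+1)) -normrM mulrBr ltr_norml.
  rewrite -natr1 in a2 c2 *; move: a1 a2 c1 c2; rewrite -!natr1; lra.
have [ltij|ltji|/val_inj eqij] := ltngtP i j.
- by exists i, j.
- by exists j, i; rewrite distrC.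
- by rewrite eqij eqxx in ij.
Qed.

(** Two of the angles i d are close modulo 2 pi, so (j - i) d is close to 0. *)
Lemma cos_recurrence d e : 0 < e ->
  exists2 p : nat, (0 < p)%N & 1 - e < cos (p%:R * d).
Proof.
move=> e0.
(* [angle_mod_2pi] is for nonnegative angles. *)
suff [p p0 dp] : exists2 p : nat, (0 < p)%N & 1 - e < cos (p%:R * `|d|).
  exists p => //; move: dp; rewrite -[X in cos X](ger0_norm (x := p%:R * `|d|)).
    by rewrite normrM normr_id -normrM cos_norm.
  by rewrite mulr_ge0.
have P0 : 0 < (pi *+ 2 : R) by rewrite pmulrn_lgt0 // pi_gt0.
have /cvgrPdist_lt /(_ e e0) := @continuous_cos R 0.
move=> [n /= n0 near_cos].
have [N Nn] : exists N : nat, (pi *+ 2) / n < N.+1%:R.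
  by exists (Num.truncn ((pi *+ 2) / n)); exact: truncnS_gt.
have [t tP] := choice (fun i => angle_mod_2pi i (normr_ge0 d)).
have t01 i : 0 <= t i < 1 by have [] := tP i.
have [i [j [ij close]]] := pigeonhole_unit_interval N t01.
exists (j - i)%N; first by rewrite subn_gt0.
rewrite natrB; last exact: ltnW.
rewrite mulrBl cosB.
have [_ -> ->] := tP i; have [_ -> ->] := tP j.
rewrite -cosB -mulrBl.
have : ball (0 : R) n ((t j - t i) * (pi *+ 2)).
  rewrite /ball /= sub0r normrN normrM (gtr0_norm P0) distrC.
  rewrite -ltr_pdivlMr //; apply: lt_trans close _.
  by rewrite -[n / _]invf_div ltf_pV2 ?posrE ?divr_gt0.
move=> /near_cos /=; rewrite cos0 => /ltr_normlP[_]; lra.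
Qed.

End Recurrence.

(** * Comparison of growth rates *)

Section GrowthComparison.
Variable R : realType.

(** The moduli give (a1 / a2)^2 = (1 + b2^2) / (1 + b1^2).  With w = p^c >= 1,
    for large p both factors lie between 1 and a multiple of w^2, so |a1 / a2| lies between
    multiples of 1 / w and w. *)
Lemma modulus_ratio_not_separated (c : R) (a1 a2 b1 b2 : nat -> R) :
  0 <= c ->
  (forall p, (0 < p)%N -> a2 p != 0) ->
  (forall p, (0 < p)%N ->
     a1 p ^+ 2 * (1 + b1 p ^+ 2) = a2 p ^+ 2 * (1 + b2 p ^+ 2)) ->
  (b1 : nat -> R^o) =O_\oo (fun p : nat => p%:R `^ c : R^o) ->
  (b2 : nat -> R^o) =O_\oo (fun p : nat => p%:R `^ c : R^o) ->
  ~ ((a1 p / a2 p * p%:R `^ c) @[p --> \oo] --> (0 : R)) /\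
  ~ ((a1 p / a2 p * p%:R `^ (- c)) @[p --> \oo] --> +oo).
Proof.
move=> c0 a2n0 modE /eqO_exP[K1 K10 B1] /eqO_exP[K2 K20 B2].
have p_gt0 : \forall p \near \oo, (0 < p)%N by exists 1%N.
have w_ge1 p : (0 < p)%N -> 1 <= (p%:R : R) `^ c.
  move=> p0; apply: le_trans (_ : 1 `^ c <= _); first by rewrite powR1.
  apply: ge0_ler_powR => //.
  - by rewrite nnegrE.
  - by rewrite nnegrE.
  - by rewrite ler1n.
have qE p : (0 < p)%N ->
    (a1 p / a2 p) ^+ 2 * (1 + b1 p ^+ 2) = 1 + b2 p ^+ 2.
  move=> p0; have a20 := a2n0 p p0.
  by rewrite expr_div_n mulrAC modE // mulrAC divff ?mul1r // expf_neq0.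
have bound (K b w : R) : 0 < K -> 1 <= w -> `|b| <= K * `|w| ->
    1 + b ^+ 2 <= (1 + K) ^+ 2 * w ^+ 2.
  move=> K0 w1; rewrite (ger0_norm (x := w)); last lra.
  move=> bK; have : `|b| ^+ 2 <= (K * w) ^+ 2.
    by rewrite ler_sqr ?nnegrE //; nra.
  rewrite real_normK ?num_real // => b2le.
  have : 1 <= w ^+ 2 by rewrite -{1}(expr1n _ 2) ler_sqr ?nnegrE; lra.
  nra.
split.
  move=> /cvgrPdist_lt /(_ (1 + K1)^-1); rewrite invr_gt0 => /(_ ltac:(lra)) small.
  have [p [p0 pb ps]] : exists p, [/\ (0 < p)%N, `|b1 p| <= K1 * `|p%:R `^ c| &
      `|0 - a1 p / a2 p * p%:R `^ c| < (1 + K1)^-1].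
    near \oo => p; exists p; split; near: p; [exact: p_gt0|exact: B1|exact: small].
  have w1 := w_ge1 p p0; have := qE p p0; have := bound _ _ _ K10 w1 pb.
  move: ps w1; rewrite sub0r normrN.
  move: (a1 p / a2 p) (b1 p) (b2 p) (_ `^ _) => q b b' w ps w1 b1le qb.
  have : `|q * w| ^+ 2 < (1 + K1)^-1 ^+ 2.
    by rewrite ltr_sqr ?nnegrE ?invr_ge0 //; lra.
  rewrite real_normK ?num_real // exprVn -[_^-1]mul1r.
  rewrite ltr_pdivlMr; last by rewrite exprn_gt0; lra.
  have : q ^+ 2 * (1 + b ^+ 2) <= q ^+ 2 * ((1 + K1) ^+ 2 * w ^+ 2).
    by rewrite ler_wpM2l // sqr_ge0.
  have := sqr_ge0 b'; rewrite exprMn; nra.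
move=> /cvgryPgt /(_ (1 + K2)) large.
have [p [p0 pb ps]] : exists p, [/\ (0 < p)%N, `|b2 p| <= K2 * `|p%:R `^ c| &
    1 + K2 < a1 p / a2 p * p%:R `^ (- c)].
  near \oo => p; exists p; split; near: p; [exact: p_gt0|exact: B2|exact: large].
have w1 := w_ge1 p p0; have := qE p p0; have := bound _ _ _ K20 w1 pb.
move: ps w1; rewrite powRN.
move: (a1 p / a2 p) (b1 p) (b2 p) (_ `^ _) => q b b' w ps w1 b2le qb.
have w0 : 0 < w by lra.
move: ps; rewrite ltr_pdivlMr // => ps.
have : ((1 + K2) * w) ^+ 2 < q ^+ 2.
  rewrite ltr_sqr ?nnegrE //; nra.
have := sqr_ge0 b; have := sqr_ge0 q; rewrite exprMn; nra.
Unshelve. all: by end_near. Qed.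

End GrowthComparison.

(** * Equality of Fourier coefficients *)

Section RotationIdentities.
Variable R : realType.

(** The hypotheses are the real and imaginary parts of
    exp (i m1) (1 + i b) = exp (i m2) (1 - i b); multiplying by 1 - i b and
    exp (- i m2) gives exp (i (m1 - m2)) (1 + b^2) = (1 - i b)^2. *)
Lemma opposite_skew_cos m1 m2 b :
  cos m1 - sin m1 * b = cos m2 + sin m2 * b ->
  sin m1 + cos m1 * b = sin m2 - cos m2 * b ->
  cos (m1 - m2) * (1 + b ^+ 2) = 1 - b ^+ 2 :> R.
Proof.
move=> re im.
have ec : cos m1 * (1 + b ^+ 2) = cos m2 * (1 - b ^+ 2) + 2 * sin m2 * b.
  transitivity ((cos m1 - sin m1 * b) + (sin m1 + cos m1 * b) * b); first by ring.
  by rewrite re im; ring.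
have es : sin m1 * (1 + b ^+ 2) = sin m2 * (1 - b ^+ 2) - 2 * cos m2 * b.
  transitivity ((sin m1 + cos m1 * b) - (cos m1 - sin m1 * b) * b); first by ring.
  by rewrite re im; ring.
transitivity ((cos m1 * (1 + b ^+ 2)) * cos m2 + (sin m1 * (1 + b ^+ 2)) * sin m2).
  by rewrite cosB; ring.
rewrite ec es.
transitivity ((1 - b ^+ 2) * (cos m2 ^+ 2 + sin m2 ^+ 2)); first by ring.
by rewrite cos2Dsin2 mulr1.
Qed.

(** Cancel 1 + i b, which never vanishes, in
    exp (i m1) (1 + i b) = exp (i m2) (1 + i b). *)
Lemma same_skew_cos m1 m2 b :
  cos m1 - sin m1 * b = cos m2 - sin m2 * b ->
  sin m1 + cos m1 * b = sin m2 + cos m2 * b ->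
  cos (m1 - m2) = 1 :> R.
Proof.
move=> re im.
have n0 : 1 + b ^+ 2 != 0 by rewrite gt_eqF // ltr_wpDr ?sqr_ge0.
have ec : cos m1 = cos m2.
  apply: (mulIf n0).
  transitivity ((cos m1 - sin m1 * b) + (sin m1 + cos m1 * b) * b); first by ring.
  by rewrite re im; ring.
have es : sin m1 = sin m2.
  apply: (mulIf n0).
  transitivity ((sin m1 + cos m1 * b) - (cos m1 - sin m1 * b) * b); first by ring.
  by rewrite re im; ring.
by rewrite cosB ec es -!expr2 cos2Dsin2.
Qed.

(** 1 - cos d = 2 sin^2 (d / 2), and the sine is positive for 0 < d < 2 pi. *)
Lemma eq_angle_of_cosB m1 m2 :
  0 <= m1 < 2 * pi -> 0 <= m2 < 2 * pi -> cos (m1 - m2) = 1 -> m1 = m2 :> R.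
Proof.
wlog le21 : m1 m2 / m2 <= m1.
  move=> wl h1 h2 cE; have [|/ltW] := leP m2 m1; first by move=> ?; exact: wl.
  by move=> le12; apply/esym/wl => //; rewrite -cosN opprB.
move=> /andP[m10 m1p] /andP[m20 m2p] cE; apply/eqP; rewrite -subr_eq0.
apply: contraT => ne0.
have d0 : 0 < m1 - m2 by rewrite lt_def ne0 subr_ge0.
have : 0 < sin ((m1 - m2) / 2).
  by apply: sin_gt0_pi; apply/andP; split; [lra | lra].
have -> : sin ((m1 - m2) / 2) = 0.
  apply/eqP; rewrite -sqrf_eq0 sin2cos2.
  have : cos (((m1 - m2) / 2) *+ 2) = 1.
    by rewrite -mulr_natr divfK // pnatr_eq0.
  by rewrite cos_mulr2n => h; apply/eqP; move: h; rewrite -mulr_natr; lra.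
by rewrite ltxx.
Qed.

(** Squared moduli in a1 exp (i m1) (1 + i b1) = a2 exp (i m2) (1 + i b2). *)
Lemma modulus_eq m1 m2 b1 b2 (a1 a2 : R) :
  a1 * (cos m1 - sin m1 * b1) = a2 * (cos m2 - sin m2 * b2) ->
  a1 * (sin m1 + cos m1 * b1) = a2 * (sin m2 + cos m2 * b2) ->
  a1 ^+ 2 * (1 + b1 ^+ 2) = a2 ^+ 2 * (1 + b2 ^+ 2).
Proof.
move=> re im.
have E (a m b : R) : a ^+ 2 * (1 + b ^+ 2) =
    (a * (cos m - sin m * b)) ^+ 2 + (a * (sin m + cos m * b)) ^+ 2.
  transitivity (a ^+ 2 * (1 + b ^+ 2) * (cos m ^+ 2 + sin m ^+ 2)); last by ring.
  by rewrite cos2Dsin2 mulr1.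
by rewrite (E a1 m1) re im -E.
Qed.

End RotationIdentities.

Section OppositeSkew.
Variable R : realType.

(** The hypothesis to refute forces cos (p (m1 - m2)) = (1 - b^2) / (1 + b^2)
    with b = l r_p, hence at most (1 - B) / (1 + B) < 1 with B = (l k)^2 for
    every p > 0, against recurrence. *)
Lemma opposite_skew_impossible (r : nat -> R) (l k m1 m2 : R) :
  l != 0 -> 0 < k -> (forall p, (0 < p)%N -> k <= `|r p|) ->
  ~ (forall p, (0 < p)%N ->
     cos (p%:R * m1) - sin (p%:R * m1) * (l * r p) =
       cos (p%:R * m2) + sin (p%:R * m2) * (l * r p) /\
     sin (p%:R * m1) + cos (p%:R * m1) * (l * r p) =
       sin (p%:R * m2) - cos (p%:R * m2) * (l * r p)).
Proof.
move=> l0 k0 rk H; pose B := (l * k) ^+ 2.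
have B0 : 0 < B by rewrite exprn_even_gt0 //= mulf_neq0 // gt_eqF.
have B1 : 0 < 1 + B by lra.
(* 2 B / (1 + B) is the distance from (1 - B) / (1 + B) to 1. *)
have [|p p0] := @cos_recurrence R (m1 - m2) (2 * B / (1 + B)).
  by rewrite divr_gt0 //; lra.
have [re im] := H p p0; have := opposite_skew_cos re im; rewrite -mulrBr.
have : B <= (l * r p) ^+ 2.
  rewrite /B !exprMn ler_wpM2l ?sqr_ge0 // -(real_normK (num_real (r p))).
  by rewrite ler_sqr ?nnegrE ?rk // ltW.
move: (cos _) ((l * r p) ^+ 2) => c b2 Bb cE; apply/negP; rewrite -leNgt.
have -> : 1 - 2 * B / (1 + B) = (1 - B) / (1 + B) by field; rewrite gt_eqF.
rewrite ler_pdivlMr //.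
have b20 : 0 < 1 + b2 by lra.
rewrite -(ler_pM2r b20) mulrAC cE; nra.
Qed.

End OppositeSkew.

Theorem theorem2 (R : realType) (k : nat) (hk : (3 <= k)%N)
    (Psi : set 'cV[R]_(k - 2)) (f0 : 'cV[R]_(k - 2) -> R -> R)
    (f0_density : forall psi, Psi psi -> circular_density (f0 psi))
    (f0_continuous : forall psi, Psi psi -> continuous (f0 psi))
    (f0_symmetric : forall psi, Psi psi -> symmetric_about0 (f0 psi))
    (ratios_defined : forall psi, Psi psi ->
       forall p : nat, (0 < p)%N -> cosine_moment (f0 psi) p != 0)
    (hi : forall psi, Psi psi -> cosine_moment (f0 psi) 1 != 0)
    (hii : forall psi, Psi psi -> exists M : R, 0 < M /\
       1 / M < inf [set `|moment_ratio (f0 psi) p| | p in [set p : nat | (0 < p)%N]])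
    (hiii : exists c : R, [/\ 0 <= c,
       forall psi, Psi psi ->
         (fun p : nat => moment_ratio (f0 psi) p : R^o)
           =O_\oo (fun p : nat => p%:R `^ c : R^o)
     & forall psi1 psi2, Psi psi1 -> Psi psi2 -> psi1 <> psi2 ->
         (cosine_moment (f0 psi1) p / cosine_moment (f0 psi2) p * p%:R `^ c)
           @[p --> \oo] --> (0 : R)
         \/
         (cosine_moment (f0 psi1) p / cosine_moment (f0 psi2) p * p%:R `^ (- c))
           @[p --> \oo] --> +oo]) :
  identifiable (sine_skewed_params Psi) (sine_skewed f0).
Proof.
case: hiii => c [c0 growth separation] [[m1 psi1] l1] [[m2 psi2] l2].
move=> [m1P Psi1 l1P] [m2P Psi2 l2P] neq same.
pose a psi p := cosine_moment (f0 psi) p; pose r psi p := moment_ratio (f0 psi) p.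
have eq_moments p : (0 < p)%N ->
    a psi1 p * (cos (p%:R * m1) - sin (p%:R * m1) * (l1 / 2 * r psi1 p)) =
    a psi2 p * (cos (p%:R * m2) - sin (p%:R * m2) * (l2 / 2 * r psi2 p)) /\
    a psi1 p * (sin (p%:R * m1) + cos (p%:R * m1) * (l1 / 2 * r psi1 p)) =
    a psi2 p * (sin (p%:R * m2) + cos (p%:R * m2) * (l2 / 2 * r psi2 p)).
  move=> p0.
  have moments psi m l : Psi psi ->
      let g x := skew (f0 psi) l (x - m) in let b := l / 2 * r psi p in
      cosine_moment g p = a psi p * (cos (p%:R * m) - sin (p%:R * m) * b) /\
      sine_moment g p = a psi p * (sin (p%:R * m) + cos (p%:R * m) * b).
    move=> Ppsi; have [_ _ per _] := f0_density _ Ppsi.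
    apply: rotated_skew_moments => //; [exact: f0_continuous|exact: f0_symmetric|].
    exact: ratios_defined.
  have cont psi m l : Psi psi -> continuous (fun x => skew (f0 psi) l (x - m)).
    move=> Ppsi x.
    apply: (@continuous_comp _ _ _ (fun x => x - m) (skew (f0 psi) l)); last first.
      by apply: continuous_skew; exact: f0_continuous.
    by apply: cvgB; [exact: cvg_id | exact: cvg_cst].
  have [<- <-] := moments psi1 m1 l1 Psi1; have [<- <-] := moments psi2 m2 l2 Psi2.
  by apply: same_distribution_moments => //; exact: cont.
have bigO_skew psi l : Psi psi ->
    (fun p => l / 2 * r psi p : R^o) =O_\oo (fun p : nat => p%:R `^ c : R^o).
  move=> /growth /eqO_exP[K K0 rK]; apply/eqO_exP.
  (* 1 is added because the constant must be positive even for l = 0. *)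
  exists ((1 + `|l / 2|) * K); first by rewrite mulr_gt0 // ltr_wpDr.
  apply: filterS rK => p rK; rewrite normrM -mulrA.
  have := normr_ge0 (l / 2); have := normr_ge0 (r psi p); rewrite -/(r psi p) in rK.
  by move: rK; move: `|_| `|_| (K * _) => x y z; nra.
have [eq_psi|/eqP neq_psi] := eqVneq psi1 psi2; last first.
  have [] := @modulus_ratio_not_separated R c (a psi1) (a psi2)
    (fun p => l1 / 2 * r psi1 p) (fun p => l2 / 2 * r psi2 p) c0.
  - by move=> p; exact: ratios_defined.
  - by move=> p /eq_moments[re im]; exact: modulus_eq re im.
  - exact: bigO_skew.
  - exact: bigO_skew.
  by have [] := separation _ _ Psi1 Psi2 neq_psi.
subst psi2.
have eq_rot p : (0 < p)%N ->
    cos (p%:R * m1) - sin (p%:R * m1) * (l1 / 2 * r psi1 p) =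
    cos (p%:R * m2) - sin (p%:R * m2) * (l2 / 2 * r psi1 p) /\
    sin (p%:R * m1) + cos (p%:R * m1) * (l1 / 2 * r psi1 p) =
    sin (p%:R * m2) + cos (p%:R * m2) * (l2 / 2 * r psi1 p).
  move=> p0; have [re im] := eq_moments p p0.
  by split; apply: (mulfI (ratios_defined _ Psi1 _ p0)).
have [M [M0 infM]] := hii _ Psi1.
have r_ge p : (0 < p)%N -> 1 / M <= `|r psi1 p|.
  move=> p0; apply/ltW/(lt_le_trans infM)/ge_inf; last by exists p.
  by exists 0 => _ [q _ <-].
have M_gt0 : 0 < 1 / M by rewrite divr_gt0.
have r1_neq0 : r psi1 1 != 0.
  by rewrite -normr_gt0 (lt_le_trans M_gt0) // r_ge.
have [re1 im1] := eq_rot 1%N isT; rewrite !mul1r in re1 im1.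
have : l1 ^+ 2 = l2 ^+ 2.
  have re := congr1 (fun t => 1 * t) re1; have im := congr1 (fun t => 1 * t) im1.
  have := modulus_eq re im; rewrite expr1n !mul1r => /addrI.
  rewrite !(exprMn 2 _ (r psi1 1%N)) !(exprMn 2 _ 2^-1) => eq_b.
  have := mulIf (expf_neq0 2 r1_neq0) eq_b.
  by apply: mulIf; rewrite expf_neq0 // invr_eq0 pnatr_eq0.
have [eq_l|neq_l] := eqVneq l1 l2.
  subst l2; case: neq; congr (_, _, _).
  by apply: eq_angle_of_cosB => //; exact: same_skew_cos re1 im1.
move=> /eqP; rewrite eqf_sqr (negPf neq_l) => /eqP opp_l.
have l2_neq0 : l2 != 0.
  by apply: contraNneq neq_l => l20; rewrite opp_l l20 oppr0.
apply: (@opposite_skew_impossible R (r psi1) (- (l2 / 2)) (1 / M) m1 m2) => //.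
  by rewrite oppr_eq0 mulf_neq0 // invr_eq0 pnatr_eq0.
move=> p /eq_rot; rewrite opp_l => -[re im]; split.
  by move: re; rewrite !mulNr !mulrN !opprK.
by move: im; rewrite !mulNr !mulrN !opprK.
Qed.
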